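(* Let $n\ge 2$. A finite configuration is realizable in the free group $\mathbb{F}_n$ if and only if it is Howson.
   Context: $\mathbb{F}_n$ is the free group of rank $n$. For $k\ge 1$, $[k]=\{1,\ldots,k\}$ and $\mathcal{P}([k])$ is its power set. A $k$-configuration is a map $\chi\colon\mathcal{P}([k])\setminus\{\varnothing\}\to\{0,1\}$; a finite configuration is a $k$-configuration for some $k\ge 1$. Subgroups $H_1,\ldots,H_k$ (possibly with repetitions) of a group $G$ realize $\chi$ if, for every nonempty $I\subseteq[k]$, the intersection $\bigcap_{i\in I}H_i$ is finitely generated when $\chi(I)=0$ and not finitely generated when $\chi(I)=1$. The configuration $\chi$ is realizable in $G$ if some $k$ subgroups of $G$ realize it. A $k$-configuration $\chi$ is Howson if, for all nonempty $I,J\subseteq[k]$, $\chi(I\cup J)=0$ whenever $\chi(I)=\chi(J)=0$. *)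

(* Defs.v *)
From HB Require Import structures.
From mathcomp Require Import all_boot.
From mathcomp Require Import classical_sets.

Set Implicit Arguments.
Unset Strict Implicit.
Unset Printing Implicit Defensive.

Local Open Scope classical_set_scope.
Local Open Scope group_scope.

Section Words.
Variable X : choiceType.

(* [(x, false)] stands for the generator [x], [(x, true)] for its inverse. *)
Definition letter := (X * bool)%type.

Definition letterV (a : letter) : letter := (a.1, ~~ a.2).

Definition reduced : pred (seq letter) :=
  sorted (fun a b : letter => b != letterV a).

(* Left multiplication of a reduced word by one letter. *)
Definition lmul (a : letter) (w : seq letter) : seq letter :=
  if w is b :: w' then if b == letterV a then w' else a :: w else [:: a].

Lemma letterVK : involutive letterV.
Proof. by case=> x b; rewrite /letterV /= negbK. Qed.

Lemma letterV_neq a : letterV a != a.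
Proof. by case: a => x []; rewrite /letterV xpair_eqE /= andbF. Qed.

Lemma reduced_behead a w : reduced (a :: w) -> reduced w.
Proof. exact: path_sorted. Qed.

Lemma reduced_lmul a w : reduced w -> reduced (lmul a w).
Proof.
case: w => [|b w] //= rw; case: eqP => [_|/eqP ne].
  exact: reduced_behead rw.
by rewrite /= ne.
Qed.

Lemma reduced_foldr u v : reduced v -> reduced (foldr lmul v u).
Proof. by move=> rv; elim: u => //= a u IHu; apply: reduced_lmul. Qed.

Lemma lmulK a w : reduced w -> lmul a (lmul (letterV a) w) = w.
Proof.
case: w => [|b w] /=; first by rewrite eqxx.
rewrite letterVK; case: (b =P a) => [-> | _ _]; last by rewrite /= eqxx.
by case: w => //= c w /andP[/negPf ->].
Qed.

Lemma lmulVK a w : reduced w -> lmul (letterV a) (lmul a w) = w.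
Proof. by move=> rw; rewrite -{2}[a]letterVK lmulK. Qed.

Lemma foldr_lmul a v w : reduced v -> reduced w ->
  foldr lmul w (lmul a v) = lmul a (foldr lmul w v).
Proof.
case: v => [|b v] //= rv rw; case: eqP => // ->.
by rewrite lmulK //; apply: reduced_foldr.
Qed.

Lemma foldr_reduced w : reduced w -> foldr lmul [::] w = w.
Proof.
elim: w => //= a w IHw rw; rewrite IHw ?(reduced_behead rw) //.
by case: w rw {IHw} => //= b w /andP[/negPf ->].
Qed.

Lemma reducedV w : reduced w -> reduced (rev (map letterV w)).
Proof.
rewrite /reduced rev_sorted sorted_map; apply: sub_sorted => a b /=.
by apply: contraNneq => ->; rewrite letterVK.
Qed.

(* The free group on [X]: reduced words, multiplied by concatenating and
   cancelling. *)
Record free_group := FreeGroup {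
  fg_word :> seq letter;
  fg_wordP : reduced fg_word }.

HB.instance Definition _ := [isSub for fg_word].
HB.instance Definition _ := [Choice of free_group by <:].

Definition fg_one : free_group := @FreeGroup [::] isT.
Definition fg_inv (u : free_group) : free_group :=
  FreeGroup (reducedV (fg_wordP u)).
Definition fg_mul (u v : free_group) : free_group :=
  FreeGroup (reduced_foldr u (fg_wordP v)).

Lemma fg_mulA : associative fg_mul.
Proof.
move=> u v w; apply: val_inj => /=.
elim: (fg_word u) => //= a s IHs; rewrite IHs foldr_lmul ?fg_wordP //.
exact: reduced_foldr (fg_wordP v).
Qed.

Lemma fg_mul1 : left_id fg_one fg_mul.
Proof. by move=> u; apply: val_inj. Qed.

Lemma fg_mulr1 : right_id fg_one fg_mul.
Proof. by move=> u; apply: val_inj; exact: foldr_reduced (fg_wordP u). Qed.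

Lemma fg_mulV : left_inverse fg_one fg_inv fg_mul.
Proof.
move=> u; apply: val_inj => /=; case: u => w /=.
elim: w => //= a w IHw rw; rewrite rev_cons -cats1 foldr_cat /=.
by rewrite letterVK eqxx IHw ?(reduced_behead rw).
Qed.

Lemma fg_invK : involutive fg_inv.
Proof.
move=> u; apply: val_inj => /=; rewrite map_rev revK -map_comp.
by rewrite (eq_map (g := id)) ?map_id // => a /=; rewrite letterVK.
Qed.

Lemma fg_mulVr : right_inverse fg_one fg_inv fg_mul.
Proof. by move=> u; rewrite -{1}[u]fg_invK fg_mulV. Qed.

HB.instance Definition _ :=
  isGroup.Build free_group fg_mulA fg_mul1 fg_mulr1 fg_mulV fg_mulVr.

Definition fg_gen (x : X) : free_group := @FreeGroup [:: (x, false)] isT.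

End Words.

Section UniversalProperty.
Variables (X : choiceType) (G : groupType) (f : X -> G).

Let ev (a : letter X) : G := if a.2 then (f a.1)^-1 else f a.1.

Definition fg_lift (u : free_group X) : G := \prod_(a <- fg_word u) ev a.

Lemma fg_liftM : {morph fg_lift : u v / u * v}.
Proof.
have evV a : ev (letterV a) = (ev a)^-1.
  by case: a => x []; rewrite /ev /= ?invgK.
move=> u v; rewrite /fg_lift /=; elim: (fg_word u) => [|a w IHw] /=.
  by rewrite big_nil mul1g.
rewrite big_cons -mulgA -IHw; case: (foldr _ _ _) => [|b t] /=.
  by rewrite big_seq1 big_nil mulg1.
case: eqP => [->|_]; last by rewrite big_cons.
by rewrite big_cons evV mulgA mulgV mul1g.
Qed.

Lemma fg_lift_gen x : fg_lift (fg_gen x) = f x.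
Proof. by rewrite /fg_lift big_seq1. Qed.

Lemma fg_lift_uniq (h : free_group X -> G) :
  {morph h : u v / u * v} -> (forall x, h (fg_gen x) = f x) -> h =1 fg_lift.
Proof.
move=> hM hf.
have h1 : h 1 = 1 by apply: (mulgI (h 1)); rewrite -hM !mulg1.
have hV x : h (fg_gen x)^-1 = (f x)^-1.
  by apply: (mulgI (f x)); rewrite mulgV -hf -hM mulgV h1.
case=> w; elim: w => [|a w IHw] rw.
  rewrite /fg_lift big_nil -h1; congr h; exact: val_inj.
have rw' := reduced_behead rw.
pose g : free_group X := @FreeGroup X [:: a] isT.
have -> : FreeGroup rw = g * FreeGroup rw'.
  apply: val_inj => /=.
  by case: w rw {IHw rw'} => //= b w /andP[/negPf ->].
rewrite hM fg_liftM IHw; congr (_ * _); rewrite /fg_lift big_seq1 /g /ev.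
case: a {rw g} => x [] /=; last by rewrite -hf; congr h; exact: val_inj.
by rewrite -hV; congr h; exact: val_inj.
Qed.

End UniversalProperty.

Section Configurations.
Variable G : groupType.

Definition is_subgroup (H : set G) : Prop :=
  [/\ H 1, (forall x y, H x -> H y -> H (x * y)) & forall x, H x -> H x^-1].

Definition generated (A : set G) : set G := smallest is_subgroup A.

Definition finitely_generated (H : set G) : Prop :=
  exists s : seq G, H = generated [set` s].

End Configurations.

Definition nonempty_subset (k : nat) := {I : {set 'I_k} | I != finset.set0}.

Lemma nonempty_subsetU_proof k (I J : nonempty_subset k) :
  sval I :|: sval J != finset.set0.
Proof. by rewrite finset.setU_eq0 negb_and (svalP I). Qed.

Definition nonempty_subsetU k (I J : nonempty_subset k) : nonempty_subset k :=
  exist _ (sval I :|: sval J) (nonempty_subsetU_proof I J).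

(* The values 0 and 1 are [false] and [true]. *)
Definition configuration (k : nat) := nonempty_subset k -> bool.

Definition realizes (G : groupType) k (H : 'I_k -> set G)
    (chi : configuration k) : Prop :=
  forall I : nonempty_subset k,
    (chi I = false -> finitely_generated (\bigcap_(i in [set` sval I]) H i)) /\
    (chi I = true -> ~ finitely_generated (\bigcap_(i in [set` sval I]) H i)).

Definition realizable (G : groupType) k (chi : configuration k) : Prop :=
  exists H : 'I_k -> set G,
    (forall i, is_subgroup (H i)) /\ realizes H chi.

Definition Howson k (chi : configuration k) : Prop :=
  forall I J : nonempty_subset k,
    chi I = false -> chi J = false -> chi (nonempty_subsetU I J) = false.

(* Main.v *)
Require Import Defs.
From mathcomp Require Import all_boot ssralg ssrint.
From mathcomp Require Import boolp classical_sets.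

(** Howson's condition is necessary because in a free group of finite rank the
    intersection of two finitely generated subgroups is finitely generated.
    Finite generation of [H] is tested on the core of its coset graph: [H] is
    finitely generated iff the prefixes of the reduced words of [H] lie in
    finitely many cosets [H * q] ([prefix_cover_fg] and [fg_prefix_cover]).  A
    prefix of a word of [H `&` K] lies in some [H * q] and in some [K * r], and
    the intersection of two such cosets is a coset of [H `&` K]; this gives
    [fgI].

    For sufficiency, the Howson condition is first put in a positive form
    ([HowsonP]): [chi J] is 1 iff some pair [(I, i)] with [i \in J \subset I]
    forces it, where [(I, i)] is isolated, i.e. [chi] is 1 on every set between
    [[set i]] and [I].  Indeed, if [i] ranges over [J] and no [(J, i)] is
    isolated, then [J] is the union of sets on which [chi] is 0.

    Let [p_1], ..., [p_N] be the isolated pairs.  Take two generators [a], [b],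
    and let [y_t = a^t b a^-t] for [0 <= t <= N]; these elements are free
    generators.  For [p_t = (I_t, i_t)], the subgroup [H_j] consists of the
    words in [y_0] and in those [y_t] with [j \in I_t] whose exponent sum in
    [y_t] vanishes whenever [i_t = j].  The intersection of the [H_j] over
    [j \in J] consists of the words in [y_0] and in those [y_t] with
    [J \subset I_t] whose exponent sum in [y_t] vanishes whenever [i_t \in J].
    If no [t] has [i_t \in J \subset I_t], the second condition is void and
    finitely many [y_t] generate.  Otherwise the conjugates of [y_0] by the
    powers of [y_t] belong to the intersection, and their prefixes [a^t b^i] lie
    in infinitely many cosets: the intersection is not finitely generated.

    The words in the [y_t] are handled through an automaton ([climb]) whose
    state is the height, i.e. the current power of [a], and a counter for an
    exponent sum.  Defining [H_j] by languages ([closed_climbs]) makes it a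
    subgroup at once, and intersections can be read off from runs. *)

Set Implicit Arguments.
Unset Strict Implicit.
Unset Printing Implicit Defensive.

Local Open Scope classical_set_scope.
Local Open Scope group_scope.

(** * Generated subgroups *)

Section Generated.
Variable G : groupType.
Implicit Types H A : set G.

Lemma is_subgroup_generated A : is_subgroup (generated A).
Proof.
split=> [K [[]] //|x y xA yA K KA|x xA K KA]; have [[_ KM KV] _] := KA.
- by apply: KM; [apply: xA | apply: yA].
- by apply: KV; apply: xA.
Qed.

Lemma sub_generated A : A `<=` generated A.
Proof. by move=> x Ax K [_]; apply. Qed.

Lemma generated_sub A H : is_subgroup H -> A `<=` H -> generated A `<=` H.
Proof. by move=> sH sAH x; apply. Qed.

Lemma is_subgroup_bigcap I (D : set I) (H : I -> set G) :
  (forall i, D i -> is_subgroup (H i)) -> is_subgroup (\bigcap_(i in D) H i).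
Proof.
move=> sH; split=> [i Di|x y Hx Hy i Di|x Hx i Di]; have [H1 HM HV] := sH i Di.
- exact: H1.
- by apply: HM; [apply: Hx | apply: Hy].
- by apply: HV; apply: Hx.
Qed.

Lemma is_subgroupI H K : is_subgroup H -> is_subgroup K -> is_subgroup (H `&` K).
Proof.
move=> [H1 HM HV] [K1 KM KV]; split=> // [x y [Hx Kx] [Hy Ky]|x [Hx Kx]].
- by split; [apply: HM | apply: KM].
- by split; [apply: HV | apply: KV].
Qed.

End Generated.

(** * Prefixes of reduced words and finite generation *)

Section Prefixes.
Variable X : choiceType.
Implicit Types (u v p : free_group X) (w : seq (letter X)).

Lemma reduced_catl w1 w2 : reduced (w1 ++ w2) -> reduced w1.
Proof. by case: w1 => //= a w1; rewrite cat_path => /andP[]. Qed.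

Lemma reduced_catr w1 w2 : reduced (w1 ++ w2) -> reduced w2.
Proof. by elim: w1 => //= a w1 IH /reduced_behead. Qed.

Lemma lmul_reduced a w : reduced (a :: w) -> lmul a w = a :: w.
Proof. by case: w => //= b w /andP[/negPf ->]. Qed.

Lemma foldr_lmul_cat w1 w2 : reduced (w1 ++ w2) -> foldr (@lmul X) w2 w1 = w1 ++ w2.
Proof.
by elim: w1 => //= a w1 IH rw; rewrite IH ?(reduced_behead rw) ?lmul_reduced.
Qed.

(** Cancellation in [u * v] removes an end of [u] and a beginning of [v], so a
    prefix of the product either stops inside [u] or has swallowed all of it. *)
Lemma prefix_mul u v p : prefix p (u * v) ->
  prefix p u \/ exists2 p', prefix (fg_word p') v & p = u * p'.
Proof.
case: u v p => u ru [v rv] [p rp] /= pre.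
suff [|[p' pre' E]] : prefix p u \/ exists2 p', prefix p' v & p = foldr (@lmul X) p' u.
- by left.
- right; have rp' : reduced p' by case/prefixP: pre' rv => ? -> /reduced_catl.
  by exists (FreeGroup rp') => //; apply: val_inj.
elim: u ru p rp pre => [|a u IH] ru p rp /=; first by right; exists p.
have {}IH := IH (reduced_behead ru).
set w := foldr _ _ _ in IH *.
have rw : reduced w by apply: reduced_foldr.
case Ew : w rw => [|b w'] rw /=.
  case: p rp => [|c p] rp; first by left.
  by case: p {rp} => [|//]; case: (c == a) => //; left; rewrite prefix0s.
case: eqP => [Eb|/eqP nb] pre.
  have rbp : reduced (b :: p) by case/prefixP: pre rw => q ->; apply: (@reduced_catl (b :: p)).
  case: (IH (b :: p) rbp); rewrite ?Ew ?prefix_cons ?eqxx //.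
    by case: u ru {IH w Ew} => //= c u /andP[nc _] /andP[/eqP bc]; rewrite -bc Eb eqxx in nc.
  case=> p' pre' E; right; exists p' => //.
  by rewrite -E /= Eb eqxx.
case: p rp pre => [|c p] rp; first by left.
rewrite /= => /andP[/eqP Ec pre]; rewrite {c}Ec in rp *.
case: (IH p (reduced_behead rp)); first by rewrite Ew.
  by move=> pu; left; rewrite eqxx.
by case=> p' pre' E; right; exists p' => //; rewrite -E lmul_reduced.
Qed.

Lemma prefix_inv u p : prefix p u^-1 ->
  exists2 p', prefix (fg_word p') u & p = u^-1 * p'.
Proof.
move=> /prefixP[r Er].
have rpr : reduced (fg_word p ++ r) by rewrite -Er; apply: fg_wordP.
pose R := FreeGroup (reduced_catr rpr).
have EpR : u^-1 = p * R by apply: val_inj => /=; rewrite foldr_lmul_cat.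
have Eu : u = R^-1 * p^-1 by rewrite -invgM -EpR invgK.
exists R^-1; last by rewrite EpR -mulgA mulgV mulg1.
have -> : fg_word u = fg_word (R^-1) ++ fg_word (p^-1).
  rewrite /= -rev_cat -map_cat -Er -[LHS]/(fg_word u) -{1}[u]invgK //.
exact: prefix_prefix.
Qed.

(** The cosets [H * p], for [p] a prefix of a reduced word of [H], are the
    vertices of the core of the coset graph of [H]; the cover says that [Q] meets
    all of them. *)
Definition prefix_cover (H : set (free_group X)) (Q : seq (free_group X)) :=
  forall h p, H h -> prefix (fg_word p) h -> exists2 q, q \in Q & H (p * q^-1).

(** The elements of [H] all of whose prefixes lie in [H * Q] form a subgroup,
    for any [Q]; when [Q] contains the prefixes of the generators, so does this
    subgroup. *)
Lemma prefix_cover_fg H : finitely_generated H -> exists Q, prefix_cover H Q.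
Proof.
move=> [s EH].
have [H1 HM HV] : is_subgroup H by rewrite EH; apply: is_subgroup_generated.
pose Q := 1 :: [seq insubd (1 : free_group X) (take i (fg_word u)) |
                u <- s, i <- iota 0 (size (fg_word u)).+1].
exists Q.
pose A := H `&` [set u | forall p, prefix (fg_word p) (fg_word u) ->
                         exists2 q, q \in Q & H (p * q^-1)].
suff sHA : H `<=` A by move=> h p /sHA[_]; apply.
rewrite {1}EH; apply: generated_sub; first split.
- split=> // -[[|//] rp] _; exists 1; first exact: mem_head.
  by rewrite invg1 mulg1; have -> : FreeGroup rp = 1 by apply: val_inj.
- move=> u v [Hu Au] [Hv Av]; split; first exact: HM.
  move=> p /prefix_mul[/Au //|[p' /Av[q Qq Hq] ->]].
  by exists q => //; rewrite -mulgA; apply: HM.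
- move=> u [Hu Au]; split; first exact: HV.
  move=> p /prefix_inv[p' /Au[q Qq Hq] ->].
  by exists q => //; rewrite -mulgA; apply: HM => //; apply: HV.
- move=> u /= su; split; first by rewrite EH; apply: sub_generated.
  move=> p pre; exists p; last by rewrite mulgV.
  rewrite inE; apply/orP; right; apply/allpairsPdep.
  exists u, (size (fg_word p)); split=> //.
    by rewrite (mem_iota 0) ltnS size_prefix.
  apply: val_inj; rewrite val_insubd; move: pre; rewrite prefixE => /eqP ->.
  by rewrite fg_wordP.
Qed.

End Prefixes.

Section FiniteAlphabet.
Variable X : finType.
Implicit Types H K : set (free_group X).

(** Reidemeister-Schreier rewriting: read a word of [H] letter by letter, keep a
    representative [q] of the coset of the prefix read so far, and write the word
    as the product of the elements [q * a * r^-1] of [H] produced by each step.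
    There are finitely many of them because the alphabet is finite. *)
Lemma fg_prefix_cover H Q :
  is_subgroup H -> prefix_cover H Q -> finitely_generated H.
Proof.
move=> sH cov; have [H1 HM HV] := sH.
pose g (a : letter X) : free_group X := @FreeGroup X [:: a] isT.
pose Q1 := 1 :: Q.
pose S := [seq x <- Q ++ [seq qa.1 * g qa.2 * r^-1 |
  qa <- [seq (q, a) | q <- Q1, a <- enum {: letter X}], r <- Q] | `[< H x >]].
exists S; apply/seteqP; split=> [h Hh|]; last first.
  by apply: generated_sub => // x /=; rewrite mem_filter => /andP[/asboolP].
have [S1 SM SV] := is_subgroup_generated [set` S].
have sSH : generated [set` S] `<=` H.
  by apply: generated_sub => // x /=; rewrite mem_filter => /andP[/asboolP].
(* The rewriting starts at the representative 1, which may be outside [Q]. *)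
suff step w (rw : reduced w) : prefix w (fg_word h) ->
    exists2 q, q \in Q1 & generated [set` S] (FreeGroup rw * q^-1).
  have [q Qq Sq] := step _ (fg_wordP h) (prefix_refl _).
  have Eh : FreeGroup (fg_wordP h) = h by apply: val_inj.
  rewrite {}Eh in Sq; rewrite -[h](mulgVK q); apply: SM => //.
  move: Qq; rewrite inE => /orP[/eqP -> //|Qq].
  apply: sub_generated => /=; rewrite mem_filter mem_cat Qq andbT.
  apply/asboolP; have -> : q = (h * q^-1)^-1 * h by rewrite invgM invgK mulgVK.
  by apply: HM => //; apply: sSH; apply: SV.
elim/last_ind: w rw => [|w a IH] rw pre.
  exists 1; first exact: mem_head.
  by rewrite invg1 mulg1; have -> : FreeGroup rw = 1 by apply: val_inj.
have rwa : reduced (w ++ [:: a]) by rewrite cats1.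
have rw' := reduced_catl rwa.
have [q Qq Sq] := IH rw' (prefix_trans (prefix_rcons _ _) pre).
have Ew : FreeGroup rw = FreeGroup rw' * g a.
  by apply: val_inj; rewrite /= (foldr_lmul_cat rwa) cats1.
have [r Qr Hr] := cov h (FreeGroup rw) Hh pre.
exists r; first by rewrite inE Qr orbT.
have E : FreeGroup rw * r^-1 = FreeGroup rw' * q^-1 * (q * g a * r^-1).
  by rewrite Ew !mulgA mulgVK.
rewrite E; apply: SM => //; apply: sub_generated => /=.
rewrite mem_filter; apply/andP; split.
  apply/asboolP; have -> : q * g a * r^-1 =
      (FreeGroup rw' * q^-1)^-1 * (FreeGroup rw * r^-1) by rewrite E mulKg.
  by apply: HM => //; apply: HV; apply: sSH.
rewrite mem_cat; apply/orP; right; apply/allpairsP.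
exists ((q, a), r); split=> //; apply/allpairsP; exists (q, a); split=> //.
by rewrite mem_enum.
Qed.

(** Howson's theorem.  A nonempty [H * q `&` K * r] is a single coset of
    [H `&` K], so the finitely many pairs [(q, r)] give a cover of [H `&` K]. *)
Theorem fgI H K : is_subgroup H -> is_subgroup K ->
  finitely_generated H -> finitely_generated K -> finitely_generated (H `&` K).
Proof.
move=> sH sK /prefix_cover_fg[Q covQ] /prefix_cover_fg[R covR].
have [_ HM HV] := sH; have [_ KM KV] := sK.
pose common q r := [set x | H (x * q^-1) /\ K (x * r^-1)].
apply: (@fg_prefix_cover _ [seq xget 1 (common q r) | q <- Q, r <- R]).
  exact: is_subgroupI.
move=> h p [Hh Kh] pre.
have [[q Qq Hq] [r Rr Kr]] := (covQ h p Hh pre, covR h p Kh pre).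
have [Hx Kx] : common q r (xget 1 (common q r)) by apply: (@xgetPex _ _ _ _); exists p.
exists (xget 1 (common q r)); first by apply/allpairsP; exists (q, r).
set x := xget _ _ in Hx Kx *.
split.
- have -> : p * x^-1 = (p * q^-1) * (x * q^-1)^-1 by rewrite invgM invgK mulgA mulgVK.
  by apply: HM => //; apply: HV.
- have -> : p * x^-1 = (p * r^-1) * (x * r^-1)^-1 by rewrite invgM invgK mulgA mulgVK.
  by apply: KM => //; apply: KV.
Qed.

End FiniteAlphabet.

(** * Subgroups accepted by partial inverse automata *)

Section InverseAutomaton.
Variables (X : choiceType) (S : Type) (step : letter X -> S -> option S).
Hypothesis stepV :
  forall a s s', step a s = Some s' -> step (letterV a) s' = Some s.

Fixpoint run (w : seq (letter X)) (s : S) : option S :=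
  if w is a :: w' then obind (run w') (step a s) else Some s.

Lemma run_cat w1 w2 s : run (w1 ++ w2) s = obind (run w2) (run w1 s).
Proof. by elim: w1 s => //= a w1 IH s; case: (step a s). Qed.

(** Reducing a word never changes the end of a run, because the step of a letter
    undoes the step of its inverse.  The converse fails: the unreduced word may
    leave the domain of the automaton. *)
Lemma run_lmul a w s s' : run (a :: w) s = Some s' -> run (lmul a w) s = Some s'.
Proof.
case: w => [//|b w] /=; case: eqP => [->|_ //].
by case Ea: (step a s) => [r|//] /=; rewrite (stepV Ea).
Qed.

Lemma runM (u v : free_group X) s s' s'' :
  run u s = Some s' -> run v s' = Some s'' -> run (u * v) s = Some s''.
Proof.
move=> us vs'; have : run (fg_word u ++ v) s = Some s'' by rewrite run_cat us.
rewrite /=; elim: (fg_word u) s {us} => //= a w IH s.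
case Ea: (step a s) => [r|//] /= /IH rw.
by apply: run_lmul; rewrite /= Ea.
Qed.

Lemma runV (u : free_group X) s s' : run u s = Some s' -> run u^-1 s' = Some s.
Proof.
rewrite /=; elim: (fg_word u) s => [|a w IH] s /=; first by case=> ->.
case Ea: (step a s) => [r|//] /= /IH wr.
by rewrite rev_cons -cats1 run_cat wr /= (stepV Ea).
Qed.

Lemma is_subgroup_run s : is_subgroup [set u : free_group X | run u s = Some s].
Proof. by split=> // [u v|u]; [apply: runM | apply: runV]. Qed.

(** The state reached by [p] depends only on the coset of [p] modulo the
    stabilizer of [s]; this bounds from below the number of cosets needed to
    cover the prefixes. *)
Lemma run_coset (p q : free_group X) s s' :
  run p s = Some s' -> run (p * q^-1) s = Some s -> run q s = Some s'.
Proof.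
move=> ps pqs; have -> : q = (p * q^-1)^-1 * p by rewrite invgM invgK mulgVK.
exact: runM (runV pqs) ps.
Qed.

End InverseAutomaton.

(** * The climbing automaton *)

Section Climb.
Variables (X : finType) (a b : X).
Hypothesis neq_ab : a != b.
Variable N : nat.
Implicit Types (al z : pred nat) (s : nat * int) (w : seq (letter X)).

(** The state [(h, m)] is a height [h <= N] and a counter [m].  The letter [a]
    moves up and [b] is allowed only at the heights in [al], so that the words
    leading from height 0 to itself are products of elements [a^h b^(+-1) a^-h]
    with [h] in [al]; the counter is the exponent sum of those with [h] in [z].
    The bound [N] leaves finitely many heights, whence finite generation when the
    counter is switched off. *)
Definition climb al z (x : letter X) s : option (nat * int) :=
  if x.1 == a then
    if x.2 then if s.1 is h.+1 then if (h < N)%N then Some (h, s.2) else None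
                else None
    else if (s.1 < N)%N then Some (s.1.+1, s.2) else None
  else if (x.1 == b) && al s.1 then
    Some (s.1, if x.2 then (s.2 - (z s.1)%:Z)%R else (s.2 + (z s.1)%:Z)%R)
  else None.

Lemma climbV al z x s s' :
  climb al z x s = Some s' -> climb al z (letterV x) s' = Some s.
Proof.
case: x s => x c [h m]; rewrite /climb /=; case: (x =P a) => _.
  case: c => /=; first by case: h => [//|h]; case: ifP => // lt [<-] /=; rewrite lt.
  by case: ifP => // lt [<-] /=; rewrite lt.
case: ifP => // /andP[-> alh] [<-] /=; rewrite alh.
by case: c => /=; rewrite ?GRing.subrK ?GRing.addrK.
Qed.

Lemma climb_ext al z z' w s : (forall h, al h -> z h = z' h) ->
  run (climb al z) w s = run (climb al z') w s.
Proof.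
move=> zz'; elim: w s => //= x w IH s.
have -> : climb al z x s = climb al z' x s.
  by rewrite /climb; case: eqP => // _; case: eqP => //= _; case: ifP => // /zz' ->.
by case: (climb _ _ x s).
Qed.

(** The height and the counter reached do not depend on the set of allowed
    heights, only whether the run is defined does: so a word runs for the
    intersection of the sets [al i] as soon as it runs for each of them.  The
    index [i0] provides the step of the letters [a], which the sets [al i] do not
    constrain. *)
Lemma climb_bigcap I (D : set I) (al : I -> pred nat) al0 z w s s' i0 :
  D i0 -> (forall h, (forall i, D i -> al i h) -> al0 h) ->
  (forall i, D i -> run (climb (al i) z) w s = Some s') ->
  run (climb al0 z) w s = Some s'.
Proof.
move=> Di0 al0P; elim: w s => [|x w IH] s runs; first exact: (runs _ Di0).
have step i : D i -> climb (al i) z x s = climb al0 z x s.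
  rewrite /climb; case: eqP => // _; case: eqP => //= Eb Di.
  have alT j : D j -> al j s.1.
    move=> Dj; have := runs j Dj; rewrite /= /climb Eb eq_sym (negPf neq_ab).
    by rewrite eqxx /=; case: ifP.
  by rewrite alT // al0P.
rewrite /= -(step _ Di0); have := runs _ Di0; rewrite /=.
case Ex: (climb _ z x s) => [r|//] _ /=.
by apply: IH => i Di; have := runs i Di; rewrite /= step // -(step _ Di0) Ex.
Qed.

Lemma climb_mono al al' z w s s' : {subset al <= al'} ->
  run (climb al z) w s = Some s' -> run (climb al' z) w s = Some s'.
Proof.
move=> sub rs; apply: (@climb_bigcap unit setT (fun=> al) al' z _ _ _ tt) => //.
by move=> h /(_ tt I) /sub.
Qed.

Lemma climb_up al z t h m : (h + t <= N)%N ->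
  run (climb al z) (nseq t (a, false)) (h, m) = Some (h + t, m)%N.
Proof.
elim: t h => [|t IH] h le; first by rewrite addn0.
have lt : (h < N)%N by apply: leq_trans le; rewrite addnS ltnS leq_addr.
have -> : run (climb al z) (nseq t.+1 (a, false)) (h, m) =
          run (climb al z) (nseq t (a, false)) (h.+1, m).
  by rewrite /= [climb _ _ _ _]/climb /= eqxx lt.
by rewrite IH addSnnS.
Qed.

Lemma climb_down al z t m : (t <= N)%N ->
  run (climb al z) (nseq t (a, true)) (t, m) = Some (0, m)%N.
Proof. by elim: t => [//|t IH] le; rewrite /= [climb _ _ _ _]/climb /= eqxx le /= IH // ltnW. Qed.

Lemma climb_side al z i c h m : al h ->
  run (climb al z) (nseq i (b, c)) (h, m) =
  Some (h, if c then m - (i * z h)%N%:Z else m + (i * z h)%N%:Z)%R.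
Proof.
move=> alh; elim: i m => [|i IH] m.
  by case: (c); rewrite mul0n ?GRing.subr0 ?GRing.addr0.
rewrite /= [climb _ _ _ _]/climb /= eq_sym (negPf neq_ab) eqxx alh /= IH.
by case: (c); rewrite mulSn PoszD ?GRing.opprD GRing.addrA.
Qed.

Definition closed_climbs al z : set (free_group X) :=
  [set u | run (climb al z) u (0, 0%R)%N = Some (0, 0%R)%N].

Lemma is_subgroup_closed_climbs al z : is_subgroup (closed_climbs al z).
Proof. exact: is_subgroup_run (@climbV al z) _. Qed.

(** If [b] is never read at height [t], its exponent sum there is zero. *)
Lemma closed_climbs_sub_uncounted al t : ~~ al t ->
  closed_climbs al pred0 `<=` closed_climbs predT (pred1 t).
Proof.
move=> alt u /= Hu; apply: (@climb_mono al) => //.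
by rewrite (@climb_ext al _ pred0) // => h alh /=; apply: contraNF alt => /eqP <-.
Qed.

Lemma climb_height al w s s' : run (climb al pred0) w s = Some s' ->
  (s.1 <= N)%N -> (s'.1 <= N)%N /\ s'.2 = s.2.
Proof.
elim: w s => [|x w IH] s /=; first by case=> ->.
rewrite /climb; case: s => h m /=; case: eqP => _.
  case: x.2; first by case: h => //= h; case: ifP => //= lt /IH E _; apply: E; apply: ltnW.
  by case: ifP => //= lt /IH E _; apply: E.
by case: ifP => //= _ /IH /=; case: x.2; rewrite ?GRing.addr0 ?GRing.subr0.
Qed.

Lemma reduced_up t : reduced (nseq t (a, false)).
Proof. by case: t => //= t; elim: t => //= t ->; rewrite /letterV xpair_eqE /= andbF. Qed.

(** With the counter switched off, a prefix is determined up to a coset by its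
    height [t <= N], hence is represented by [a^t]. *)
Lemma closed_climbs_fg al : finitely_generated (closed_climbs al pred0).
Proof.
pose up t := FreeGroup (reduced_up t).
pose Q := [seq up t | t <- iota 0 N.+1].
apply: (@fg_prefix_cover _ _ Q).
  exact: is_subgroup_closed_climbs.
move=> h p Hh /prefixP[r Er]; rewrite /closed_climbs /= Er run_cat in Hh.
case Ep: (run _ p _) Hh => [[t m]|//] _.
have /= [tN m0] := climb_height Ep (leq0n N); rewrite {}m0 in Ep.
exists (up t); first by apply/mapP; exists t; rewrite // mem_iota.
apply: (runM (@climbV al pred0) Ep); apply: (runV (@climbV _ _)).
by rewrite /= climb_up.
Qed.

(** [a^t b^i a^-t b a^t b^-i a^-t], the conjugate of [y_0 = b] by the [i]-th power
    of [y_t = a^t b a^-t]. *)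
Definition probe t i : seq (letter X) :=
  nseq t (a, false) ++ nseq i (b, false) ++ nseq t (a, true) ++ (b, false) ::
  nseq t (a, false) ++ nseq i (b, true) ++ nseq t (a, true).

Lemma reduced_probe t i : reduced (probe t.+1 i.+1).
Proof.
have ba : b != a by rewrite eq_sym.
have pathn c x w n :
  path (fun u v : letter X => v != letterV u) (x, c) (nseq n (x, c) ++ w) =
  path (fun u v : letter X => v != letterV u) (x, c) w.
  by elim: n => //= n ->; rewrite /letterV xpair_eqE eqxx; case: c.
have pathn0 c x n :
  path (fun u v : letter X => v != letterV u) (x, c) (nseq n (x, c)).
  by rewrite -[nseq _ _]cats0 pathn.
rewrite /reduced /probe /= pathn /= pathn /= pathn /= pathn /= pathn /= pathn0.
by rewrite /letterV !xpair_eqE /= (negPf neq_ab) (negPf ba).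
Qed.

(** A conjugate of [y_0] has zero exponent sum in any [y_h] with [h != 0]. *)
Lemma probe_closed_climb al z t i (r : reduced (probe t i)) : (t <= N)%N ->
  al 0%N -> al t -> z 0%N = false -> closed_climbs al z (FreeGroup r).
Proof.
move=> tN al0 alt z0; rewrite /closed_climbs /= /probe.
rewrite run_cat climb_up //= add0n run_cat climb_side //=.
rewrite run_cat climb_down //= [climb _ _ _ _]/climb /= eq_sym (negPf neq_ab).
rewrite eqxx al0 /= z0 GRing.addr0 run_cat climb_up //= add0n.
by rewrite run_cat climb_side //= GRing.add0r GRing.subrr climb_down.
Qed.

(** The prefix [a^t b^i] of the probe brings the counter at [t] to [i], so no
    finite set of cosets covers all these prefixes. *)
Lemma closed_climbs_not_fg al (Z : set nat) t :
  al 0%N -> al t -> Z t -> ~ Z 0%N -> (t <= N)%N ->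
  ~ finitely_generated
    (closed_climbs al pred0 `&` \bigcap_(z in Z) closed_climbs predT (pred1 z)).
Proof.
move=> al0 alt Zt Z0 tN /prefix_cover_fg[Q cov].
case: t Zt alt tN => [//|t] Zt alt tN.
pose ct (q : free_group X) :=
  (odflt (0, 0%R)%N (run (climb predT (pred1 t.+1)) q (0, 0%R)%N)).2.
have : {subset [seq Posz i.+1 | i <- iota 0 (size Q).+1] <= map ct Q}.
  move=> _ /mapP[i _ ->].
  have rp : reduced (nseq t.+1 (a, false) ++ nseq i.+1 (b, false)).
    by apply: (@reduced_catl _ _ _); have := reduced_probe t i; rewrite /probe catA; apply.
  have [||q Qq [_ Hq]] := cov (FreeGroup (reduced_probe t i)) (FreeGroup rp).
  - split; first exact: probe_closed_climb.
    move=> z Zz; apply: probe_closed_climb => //=.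
    by apply/negbTE/eqP => z0; rewrite -z0 in Zz.
  - by apply/prefixP; eexists; apply: catA.
  have : run (climb predT (pred1 t.+1)) (FreeGroup rp) (0, 0%R)%N = Some (t.+1, Posz i.+1).
    by rewrite run_cat climb_up // add0n [obind _ _]climb_side //= eqxx muln1 GRing.add0r.
  move/(run_coset (@climbV _ _))/(_ (Hq _ Zt)) => Eq.
  by apply/mapP; exists q; rewrite // /ct Eq.
move/uniq_leq_size; rewrite map_inj_uniq ?iota_uniq; last by move=> i j [].
by rewrite !size_map size_iota ltnn => /(_ isT).
Qed.

End Climb.

(** * Howson configurations *)

Section Witnesses.
Variables (k : nat) (chi : configuration k).

Definition isolated (p : {set 'I_k} * 'I_k) : Prop :=
  forall J : nonempty_subset k,
    p.2 \in sval J -> sval J \subset p.1 -> chi J = true.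

(** If no [(J, i)] with [i] in [J] is isolated, every [i] in [J] lies in some
    [K \subset J] with [chi K = false]; the Howson condition lets such [K] grow
    by unions until they fill [J]. *)
Lemma HowsonP : Howson chi -> forall J, chi J = true <->
  exists2 p, isolated p & p.2 \in sval J /\ sval J \subset p.1.
Proof.
move=> HC J; split=> [chiJ|[p iso [iJ sJ]]]; last exact: iso.
apply: contrapT => noiso.
have cover i : i \in sval J -> exists K : nonempty_subset k,
    [/\ i \in sval K, sval K \subset sval J & chi K = false].
  move=> iJ; apply: contrapT => noK; apply: noiso; exists (sval J, i) => //.
  by move=> K /= iK KJ; apply: contrapT => /negP/negbTE cK; apply: noK; exists K.
have grow m : (m < #|sval J|)%N -> exists K : nonempty_subset k,
    [/\ (m < #|sval K|)%N, sval K \subset sval J & chi K = false].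
  elim: m => [|m IH] lt.
    have [i iJ] := card_gt0P lt; have [K [iK KJ cK]] := cover i iJ.
    by exists K; split=> //; apply/card_gt0P; exists i.
  have [K [mK KJ cK]] := IH (ltnW lt).
  case: (ltnP m.+1 #|sval K|) => [ltK|leK]; first by exists K.
  have /subsetPn[i iJ iK] : ~~ (sval J \subset sval K).
    by apply: contraL lt => /subset_leq_card JK; rewrite -leqNgt (leq_trans JK).
  have [L [iL LJ cL]] := cover i iJ.
  exists (nonempty_subsetU K L); split; last exact: HC.
    apply: leq_ltn_trans mK _; apply: proper_card; apply/properP.
    by split; [apply: finset.subsetUl | exists i; rewrite // finset.inE iL orbT].
  by rewrite /= finset.subUset KJ LJ.
have J0 : (0 < #|sval J|)%N by rewrite finset.card_gt0 (svalP J).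
have [|K [JK KJ cK]] := grow #|sval J|.-1; first by rewrite prednK.
rewrite prednK // in JK.
have EKJ : K = J by apply: val_inj; apply/eqP; rewrite eqEcard KJ JK.
by rewrite -EKJ cK in chiJ.
Qed.

End Witnesses.

(** * Realization *)

Section Realization.
Variables (X : finType) (a b : X).
Hypothesis neq_ab : a != b.

Lemma Howson_realizable k (chi : configuration k) :
  Howson chi -> realizable (free_group X) chi.
Proof.
move=> /HowsonP chiP.
pose s := [seq p <- enum {: {set 'I_k} * 'I_k} | `[< isolated chi p >]].
pose N := size s.
have sP p : (p \in s) = `[< isolated chi p >] by rewrite mem_filter mem_enum andbT.
(* The height 0 carries no label: it is reserved for the generator [y_0], which
   belongs to all the subgroups. *)
pose label t := if t is t'.+1 then onth s t' else None.
have labelP t p : label t = Some p -> isolated chi p /\ (t <= N)%N.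
  case: t => //= t Et; split; last by rewrite -onthTE Et.
  by apply/asboolP; rewrite -sP; apply/onthP; exists t.
have label_onto p : isolated chi p -> exists t, label t = Some p.
  by move=> iso; have /onthP[t Et] : p \in s; [rewrite sP; apply/asboolP | exists t.+1].
pose al (P : pred ({set 'I_k} * 'I_k)) (h : nat) := (h == 0%N) || oapp P false (label h).
pose Z (j : 'I_k) := [set t | exists2 p, label t = Some p & p.2 = j].
pose H (j : 'I_k) := closed_climbs a b N (al (fun p => j \in p.1)) pred0 `&`
              \bigcap_(t in Z j) closed_climbs a b N predT (pred1 t).
exists H; split=> [j|J].
  apply: is_subgroupI; first exact: is_subgroup_closed_climbs.
  by apply: is_subgroup_bigcap => t _; apply: is_subgroup_closed_climbs.
pose alJ := al (fun p => sval J \subset p.1).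
pose ZJ := \bigcup_(j in [set` sval J]) Z j.
have -> : \bigcap_(j in [set` sval J]) H j =
    closed_climbs a b N alJ pred0 `&` \bigcap_(t in ZJ) closed_climbs a b N predT (pred1 t).
  apply/seteqP; split=> u.
    move=> Hu; split; last by move=> t [j Jj Zt]; apply: (Hu j Jj).2.
    have /set0Pn[j0 Jj0] := svalP J.
    apply: (@climb_bigcap _ _ _ neq_ab N _ [set` sval J] _ _ _ _ _ _ j0 Jj0); last first.
      by move=> j Jj; apply: (Hu j Jj).1.
    move=> h alh; rewrite /alJ /al; case: eqP => //= h0.
    case El: (label h) => [p|] /=.
      apply/fintype.subsetP => j Jj.
      by have := alh j Jj; rewrite /al El; case: eqP.
    by have := alh j0 Jj0; rewrite /al El; case: eqP.
  case=> Fu Eu j Jj; split; last by move=> t Zt; apply: Eu; exists j.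
  apply: (@climb_mono _ _ _ neq_ab N alJ) Fu => h; rewrite !unfold_in /alJ /al.
  case: eqP => //= _; case: (label h) => //= p /fintype.subsetP; exact.
split=> cJ; last first.
  have [p iso [pJ Jp]] := (chiP J).1 cJ.
  have [t Et] := label_onto p iso; have [_ tN] := labelP _ _ Et.
  apply: (closed_climbs_not_fg neq_ab _ _ _ _ tN) => //.
  - by rewrite /alJ /al Et orbC /= Jp.
  - by exists p.2 => //; exists p.
  - by case=> j _ [q].
suff -> : closed_climbs a b N alJ pred0 `&`
    \bigcap_(t in ZJ) closed_climbs a b N predT (pred1 t) =
    closed_climbs a b N alJ pred0 by apply: closed_climbs_fg.
apply/setIidPl => u Fu t [j Jj [p Ep pj]].
apply: (@closed_climbs_sub_uncounted _ _ _ neq_ab N alJ) Fu.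
apply/negP; rewrite /alJ /al Ep /=; case: eqP => [t0|_ /= Jp]; first by rewrite t0 in Ep.
have [iso _] := labelP _ _ Ep.
by have := (chiP J).2; rewrite cJ => /(_ _)/notF; apply; exists p => //; rewrite pj.
Qed.

End Realization.

Theorem theorem6p7 (n : nat) (hn : (2 <= n)%N) (k : nat) (hk : (1 <= k)%N)
    (chi : configuration k) :
  realizable (free_group 'I_n) chi <-> Howson chi.
Proof.
split=> [[H [sH real]] I J cI cJ|]; last first.
  exact: (@Howson_realizable _ (Ordinal (ltnW hn)) (Ordinal hn)).
apply/negP => /(real _).2; apply.
have -> : [set` sval (nonempty_subsetU I J)] = [set` sval I] `|` [set` sval J].
  by apply/seteqP; split=> i /=; rewrite finset.inE => /orP.
rewrite bigcap_setU; apply: fgI; try by apply: is_subgroup_bigcap.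
- exact: (real I).1.
- exact: (real J).1.
Qed.
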